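(* Let $q\in\mathbb{C}$ with $0<|q|<1$, let $a,b,c$ be integers with $a,c>0$ and $b>-\sqrt{ac}$. For $x,y\in\mathbb{C}\setminus\{0\}$ and $\ell,k\in\mathbb{Z}$, $$\begin{aligned}g_{a,b,c}(x,y,q)={}&(-x)^{\ell}(-y)^kq^{a\binom{\ell}{2}+b\ell k+c\binom{k}{2}}\,g_{a,b,c}(q^{a\ell+bk}x,q^{b\ell+ck}y,q)\\&+\sum_{r=0}^{\ell-1}(-x)^{r}q^{a\binom{r}{2}}\sum_{s\in\mathbb{Z}}\mathrm{sg}(s)(-y)^sq^{brs}q^{c\binom{s}{2}}+\sum_{s=0}^{k-1}(-y)^{s}q^{c\binom{s}{2}}\sum_{r\in\mathbb{Z}}\mathrm{sg}(r)(-x)^rq^{brs}q^{a\binom{r}{2}}\\&-2\sum_{r=0}^{\ell-1}\sum_{s=0}^{k-1}(-x)^{r}(-y)^{s}q^{a\binom{r}{2}+brs+c\binom{s}{2}}.\end{aligned}$$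
   Context: For $0<|q|<1$, $x,y\in\mathbb{C}\setminus\{0\}$ and integers $a,b,c$ with $a,c>0$, $b>-\sqrt{ac}$, define $$g_{a,b,c}(x,y,q):=\Big(\sum_{r,s\ge 0}+\sum_{r,s<0}\Big)(-1)^{r+s}x^ry^sq^{a\binom{r}{2}+brs+c\binom{s}{2}},$$ where $r,s$ run over integers and $\binom{n}{2}=n(n-1)/2$ for every $n\in\mathbb{Z}$. For an integer $r$, $\mathrm{sg}(r)=1$ if $r\ge 0$ and $\mathrm{sg}(r)=-1$ if $r<0$. Convention for finite sums: when $B<A$, $\sum_{r=A}^{B}c_r:=-\sum_{r=B+1}^{A-1}c_r$ (in particular $\sum_{r=A}^{A-1}c_r=0$). *)

(* Defs.v *)
From mathcomp Require Import all_boot all_order all_algebra.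
From mathcomp Require Import complex.
From mathcomp Require Import reals topology normedtype.
From mathcomp Require summability.
Import Order.TTheory GRing.Theory Num.Theory numFieldNormedType.Exports.

Set Implicit Arguments.
Unset Strict Implicit.
Unset Printing Implicit Defensive.

Local Open Scope ring_scope.
Local Open Scope complex_scope.

(* Unordered summation: the limit of the finite partial sums along the directed
   set of finite subsets of I, with a junk value when that limit does not exist.
   For an absolutely convergent series, such as the one defining g when
   0 < |q| < 1, a, c > 0 and b > - sqrt (a c), it agrees with any iterated
   summation.  R[i]^o is R[i] as a normed module over itself rather than over
   R. *)
Definition csum (R : realType) (I : choiceType) (f : I -> R[i]) : R[i] :=
  @summability.sum I R[i] R[i]^o f.

Definition csum_on (R : realType) (I : choiceType) (D : pred I)
    (f : I -> R[i]) : R[i] :=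
  csum (fun i => if D i then f i else 0).

(* n(n-1)/2 for every integer n; the division is exact. *)
Definition binz2 (n : int) : int := (n * (n - 1) %/ 2)%Z.

(* Unlike Num.sg, this takes the value 1 at 0. *)
Definition sg (r : int) : int := if 0 <= r then 1 else -1.

(* Sum of c over A <= r <= B, with the convention that for B < A it is
   - \sum_(B + 1 <= r <= A - 1) c r. *)
Definition zsum (V : zmodType) (A B : int) (c : int -> V) : V :=
  if A <= B then \sum_(i < absz (B - A + 1)%R) c (A + i%:Z)
  else - \sum_(i < absz (A - 1 - B)%R) c (B + 1 + i%:Z).

Definition g (R : realType) (a b c : int) (x y q : R[i]) : R[i] :=
  let t := fun p : int * int =>
    (-1) ^ (p.1 + p.2) * x ^ p.1 * y ^ p.2
      * q ^ (a * binz2 p.1 + b * p.1 * p.2 + c * binz2 p.2) in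
  csum_on (fun p : int * int => (0 <= p.1) && (0 <= p.2)) t
  + csum_on (fun p : int * int => (p.1 < 0) && (p.2 < 0)) t.

(* Main.v *)
Require Import Defs.
From mathcomp Require Import all_boot all_order all_algebra.
From mathcomp Require Import complex reals.
From mathcomp Require Import finmap boolp classical_sets topology normedtype.
From mathcomp Require Import sequences.
From mathcomp Require Import zify ring lra.
From mathcomp Require summability.
Import Order.TTheory GRing.Theory Num.Theory numFieldNormedType.Exports.
Import ComplexField.Normc.
Local Open Scope ring_scope.
Local Open Scope complex_scope.

(* Let T(r,s) be the (r,s) term of the series g, and let P, P', S, S' be the
   indicators of r >= 0, r >= l, s >= 0, s >= k. Reindexing by (r+l, s+k) turns
   the right-hand g into the sum of T over the two shifted quadrants, so the
   identity is the termwise comparison of weights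
     PS + (1-P)(1-S) = P'S' + (1-P')(1-S')
       + (P-P')(2S-1) + (S-S')(2P-1) - 2(P-P')(S-S'),
   where 2P-1 = sg r, 2S-1 = sg s, and P-P', S-S' are the weights of the signed
   finite sums. All series involved converge absolutely: where rs >= 0, the
   hypothesis on b makes the quadratic form positive definite, and Gaussian
   decay beats any geometric growth. *)

(** * Unordered sums and their linearity *)

(** Unlike [csum], which has a value even for divergent families, this carries convergence; [K] is
    generic so as to cover both [R] and [R[i]]. *)
Definition has_sum {K : numFieldType} {I : choiceType} (f : I -> K) (s : K)
    : Prop :=
  (@summability.partial_sum I K^o f @ summability.totally --> (s : K^o))%classic.

Lemma partial_sumE {I : choiceType} {V : zmodType} (f : I -> V) (A : {fset I}) :
  summability.partial_sum f A = \sum_(i <- A) f i.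
Proof. by rewrite big_seq_fsetE. Qed.

Lemma has_sumP {K : numFieldType} {I : choiceType} (f : I -> K) (s : K) :
  has_sum f s <-> forall e : K, 0 < e -> exists A : {fset I},
    forall B : {fset I}, (A `<=` B)%fset -> `|s - \sum_(i <- B) f i| < e.
Proof.
have FF := @summability.totally_filter I.
split=> [h e e0|h].
  have /cvgrPdist_lt /(_ e e0) [A _ AB] := h.
  by exists A => B /AB /=; rewrite partial_sumE.
apply/cvgrPdist_lt => e /h [A AB]; exists A => // B /AB /=.
by rewrite partial_sumE.
Qed.

Lemma has_sum_csum {R : realType} {I : choiceType} (f : I -> R[i]) (s : R[i]) :
  has_sum f s -> csum f = s.
Proof.
have FF := @summability.totally_filter I.
by move=> h; apply: cvg_lim h; exact: norm_hausdorff.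
Qed.

Lemma has_sumD {K : numFieldType} {I : choiceType} (f g : I -> K) (s t : K) :
  has_sum f s -> has_sum g t -> has_sum (fun i => f i + g i) (s + t).
Proof.
have FF := @summability.totally_filter I.
move=> hf hg; rewrite /has_sum.
have -> : @summability.partial_sum I K^o (fun i => f i + g i) =
    @summability.partial_sum I K^o f \+ @summability.partial_sum I K^o g.
  by apply/funext => A; rewrite /summability.partial_sum /= big_split.
exact: (@cvgD K K^o).
Qed.

Lemma has_sumZ {K : numFieldType} {I : choiceType} (c : K) (f : I -> K) (s : K) :
  has_sum f s -> has_sum (fun i => c * f i) (c * s).
Proof.
have FF := @summability.totally_filter I.
move=> hf; rewrite /has_sum.
have -> : @summability.partial_sum I K^o (fun i => c * f i) =
    (fun A => c * @summability.partial_sum I K^o f A).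
  by apply/funext => A; rewrite /summability.partial_sum /= mulr_sumr.
exact: (@cvgMl_tmp K _ _ _ _ c).
Qed.

Lemma has_sumN {K : numFieldType} {I : choiceType} (f : I -> K) (s : K) :
  has_sum f s -> has_sum (fun i => - f i) (- s).
Proof.
move=> /(has_sumZ (-1)); rewrite mulN1r.
by under eq_fun do rewrite mulN1r.
Qed.

Lemma has_sum0 {K : numFieldType} {I : choiceType} :
  has_sum (fun _ : I => 0 : K) 0.
Proof.
apply/has_sumP => e e0; exists fset0 => B _.
by rewrite big1 // subrr normr0.
Qed.

Lemma has_sum_big {K : numFieldType} {I : choiceType} (n : nat)
    (f : 'I_n -> I -> K) (s : 'I_n -> K) :
  (forall j, has_sum (f j) (s j)) ->
  has_sum (fun i => \sum_j f j i) (\sum_j s j).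
Proof.
move=> h; rewrite unlock; elim: (index_enum _) => [|j r IH] /=.
  exact: has_sum0.
exact: has_sumD.
Qed.

Lemma has_sum_zsum {K : numFieldType} {I : choiceType} (A B : int)
    (f : int -> I -> K) (s : int -> K) :
  (forall r, has_sum (f r) (s r)) ->
  has_sum (fun i => zsum A B (f^~ i)) (zsum A B s).
Proof.
move=> h; rewrite /zsum; case: ifP => _; last apply: has_sumN;
  exact: has_sum_big.
Qed.

(** A finite set [B] has the same sum of [f] as its trace on the image of [u], and the preimage of
    that trace contains [A] once [B] contains the image of [A]. This serves to translate the lattice
    and to embed lines in it. *)
Lemma has_sum_inj {K : numFieldType} {I J : choiceType} (u : J -> I) (v : I -> J)
    (f : I -> K) (s : K) :
  cancel u v -> (forall i, u (v i) != i -> f i = 0) ->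
  has_sum (f \o u) s -> has_sum f s.
Proof.
move=> uK f0 /has_sumP h; apply/has_sumP => e /h [A AB].
exists (u @` A)%fset => B /fsubsetP sB.
pose C := [fset i in B | u (v i) == i]%fset.
have := AB (v @` C)%fset; rewrite big_imfset /=; last first.
  move=> i j; rewrite !inE => /andP[_ /eqP iE] /andP[_ /eqP jE] vij.
  by rewrite -iE vij jE.
rewrite (eq_big_seq f); last by move=> i; rewrite !inE => /andP[_ /eqP /= ->].
rewrite -(@big_fset_incl _ _ _ _ C B); last first.
- by move=> i iB; rewrite !inE iB /=; apply: f0.
- by apply/fsubsetP => i; rewrite !inE => /andP[].
apply; apply/fsubsetP => j jA; apply/imfsetP; exists (u j) => /=.
  by rewrite !inE uK eqxx andbT; apply: sB; apply: in_imfset.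
by rewrite uK.
Qed.

Lemma has_sum_single {K : numFieldType} {I : choiceType} (i0 : I) (x : K) :
  has_sum (fun i => if i == i0 then x else 0) x.
Proof.
apply/has_sumP => e e0; exists [fset i0]%fset => B; rewrite fsub1set => iB.
rewrite -(@big_fset_incl _ _ _ _ [fset i0]%fset B) ?fsub1set //; last first.
  by move=> i _; rewrite inE => /negPf ->.
by rewrite big_seq_fset1 eqxx subrr normr0.
Qed.

(** * Absolute convergence *)

Lemma ler_sum_fset {R : numDomainType} {I : choiceType} (A B : {fset I})
    (f : I -> R) :
  (forall i, 0 <= f i) -> (A `<=` B)%fset ->
  \sum_(i <- A) f i <= \sum_(i <- B) f i.
Proof.
move=> f0 sAB; rewrite [leRHS](big_fsetID _ (mem A)) /=.
rewrite (_ : [fset x in B | x \in A]%fset = A).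
  by rewrite lerDl; apply: sumr_ge0.
apply/fsetP => i; rewrite !inE /=.
by case: (boolP (i \in A)); rewrite ?andbF // => /(fsubsetP sAB) ->.
Qed.

Definition bounded_sums {R : numDomainType} {I : choiceType} (f : I -> R)
    : Prop :=
  exists M, forall A : {fset I}, \sum_(i <- A) f i <= M.

(** Finite sums increase with the index set, so they converge to their supremum. *)
Lemma has_sum_ge0 {R : realType} {I : choiceType} (f : I -> R) :
  (forall i, 0 <= f i) -> bounded_sums f -> exists s, has_sum f s.
Proof.
move=> f0 [M fM].
pose E := [set x | exists A : {fset I}, x = \sum_(i <- A) f i]%classic.
have supE : has_sup E.
  split; first by exists (\sum_(i <- fset0) f i); exists fset0.
  by exists M => _ [A ->].
exists (sup E); apply/has_sumP => e e0.
have [_ [A ->] Ae] := sup_adherent e0 supE.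
exists A => B AB.
have le1 := ler_sum_fset _ _ _ f0 AB.
have le2 : \sum_(i <- B) f i <= sup E.
  by apply: ub_le_sup; [exact: supE.2 | exists B].
rewrite ger0_norm ?subr_ge0 //; lra.
Qed.

Lemma le_bounded_sums {R : numDomainType} {I : choiceType} (f g : I -> R) :
  (forall i, f i <= g i) -> bounded_sums g -> bounded_sums f.
Proof.
move=> fg [M gM]; exists M => A; apply: le_trans (gM A).
by apply: ler_sum => i _.
Qed.

Lemma bounded_sumsM {R : numDomainType} {I : choiceType} (c : R) (f : I -> R) :
  0 <= c -> bounded_sums f -> bounded_sums (fun i => c * f i).
Proof.
by move=> c0 [M fM]; exists (c * M) => A; rewrite -mulr_sumr ler_wpM2l.
Qed.

(** Here [f] is split as [(|f| + f) - |f|], a difference of nonnegative families, the first of them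
    at most [2 |f|]. *)
Lemma has_sum_real {R : realType} {I : choiceType} (f : I -> R) :
  bounded_sums (fun i => `|f i|) -> exists s, has_sum f s.
Proof.
move=> bf.
have [s hs] : exists s, has_sum (fun i => `|f i|) s by apply: has_sum_ge0.
have [t ht] : exists t, has_sum (fun i => `|f i| + f i) t.
  apply: has_sum_ge0 => [i|].
    by have := ler_norm (- f i); rewrite normrN; lra.
  apply: (le_bounded_sums _ (fun i => 2 * `|f i|)); last exact: bounded_sumsM.
  by move=> i; have := ler_norm (f i); lra.
exists (t - s); rewrite (_ : f = fun i => `|f i| + f i - `|f i|).
  by apply: has_sumD => //; apply: has_sumN.
by apply/funext => i; rewrite addrC addKr.
Qed.

Lemma normCE {R : rcfType} (z : R[i]) : `|z| = (normc z)%:C.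
Proof. by []. Qed.

Lemma normc_ge0 {R : rcfType} (z : R[i]) : 0 <= normc z.
Proof. by rewrite -ler0c -normCE. Qed.

Lemma normc_real {R : rcfType} (x : R) : normc x%:C = `|x|.
Proof. by rewrite /= expr0n addr0 sqrtr_sqr. Qed.

Lemma has_sum_real_complex {R : realType} {I : choiceType} (f : I -> R) (s : R) :
  has_sum f s -> has_sum (fun i => (f i)%:C) s%:C.
Proof.
move=> /has_sumP h; apply/has_sumP => e e0.
(* A positive [e] of [R[i]] has zero imaginary part, so its real part is a tolerance in [R]. *)
have eE : (complex.Re (e : R[i]))%:C = e by apply: RRe_real; apply: gtr0_real.
have [|A AB] := h (complex.Re (e : R[i])); first by rewrite -ltcR eE.
exists A => B /AB; rewrite -ltcR eE.
by rewrite -rmorph_sum -rmorphB normCE normc_real.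
Qed.

Lemma Re_le_normc {R : rcfType} (z : R[i]) : `|complex.Re z| <= normc z.
Proof.
case: z => x y /=; rewrite -sqrtr_sqr; apply: ler_wsqrtr.
by rewrite lerDl sqr_ge0.
Qed.

Lemma Im_le_normc {R : rcfType} (z : R[i]) : `|complex.Im z| <= normc z.
Proof.
case: z => x y /=; rewrite -sqrtr_sqr; apply: ler_wsqrtr.
by rewrite lerDr sqr_ge0.
Qed.

(** The modulus dominates the real and imaginary parts, which are summed separately. The conclusion
    rules out the junk value of [csum]. *)
Lemma abs_summable {R : realType} {I : choiceType} (f : I -> R[i]) :
  bounded_sums (fun i => normc (f i)) -> has_sum f (csum f).
Proof.
move=> bf.
have [s hs] : exists s, has_sum (fun i => complex.Re (f i)) s.
  by apply/has_sum_real/le_bounded_sums/bf => i; apply: Re_le_normc.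
have [t ht] : exists s, has_sum (fun i => complex.Im (f i)) s.
  by apply/has_sum_real/le_bounded_sums/bf => i; apply: Im_le_normc.
have h : has_sum f (s%:C + 'i%C * t%:C).
  rewrite (_ : f = fun i => (complex.Re (f i))%:C + 'i%C * (complex.Im (f i))%:C).
    by apply: has_sumD; [|apply: has_sumZ]; exact: has_sum_real_complex.
  by apply/funext => i; exact: complexE.
by rewrite (has_sum_csum _ _ h).
Qed.

(** * Geometric majorants on the integers and on pairs *)

(** [absz] is injective on the nonnegative and on the negative integers, so each half contributes
    distinct powers of 1/2, hence at most 2. *)
Lemma bounded_sums_geom {R : realFieldType} :
  bounded_sums (fun r : int => (2^-1 : R) ^+ `|r|%N).
Proof.
have sum_le (s : seq nat) : uniq s -> \sum_(i <- s) (2^-1 : R) ^+ i <= 2.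
  move=> us.
  have [n nE] : exists n, n = (\max_(i <- s) i).+1 by eexists.
  apply: (@le_trans _ _ (\sum_(i <- iota 0 n) (2^-1 : R) ^+ i)).
    rewrite [leRHS](bigID (mem s)) /= -[X in _ <= X + _]big_filter.
    rewrite [X in _ <= X + _](perm_big s) /=; last first.
      apply: uniq_perm => //; first by rewrite filter_uniq ?iota_uniq.
      move=> i; rewrite mem_filter mem_iota /=.
      by case: (boolP (i \in s)) => //= is_; rewrite nE ltnS leq_bigmax_seq.
    by rewrite lerDl; apply: sumr_ge0 => i _; apply: exprn_ge0; lra.
  have -> m : \sum_(i <- iota 0 m) (2^-1 : R) ^+ i = 2 - 2 * 2^-1 ^+ m.
    elim: m => [|m IH]; first by rewrite big_nil expr0; lra.
    rewrite -addn1 iotaD big_cat big_seq1 IH add0n addn1 exprS.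
    by move: (_ ^+ m) => h /=; lra.
  by rewrite gerBl mulr_ge0 // exprn_ge0 //; lra.
have half (P : pred int) : {in P &, injective absz} ->
    forall A : {fset int}, \sum_(r <- A | P r) (2^-1 : R) ^+ `|r|%N <= 2.
  move=> Pinj A; rewrite -big_filter.
  rewrite -(big_map absz xpredT (fun n => (2^-1 : R) ^+ n)).
  apply: sum_le; rewrite map_inj_in_uniq ?filter_uniq ?fset_uniq // => i j.
  by rewrite !mem_filter => /andP[Pi _] /andP[Pj _]; apply: Pinj.
exists 4 => A; rewrite (bigID (fun r : int => 0 <= r)) /=.
have h1 := half (fun r : int => 0 <= r) _ A.
have h2 := half (fun r : int => ~~ (0 <= r)) _ A.
have := lerD (h1 _) (h2 _); rewrite -natrD; apply.
- by move=> i j; rewrite !unfold_in; lia.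
- by move=> i j; rewrite !unfold_in; lia.
Qed.

(** A finite set of pairs lies in the product of its two projections, over which the sum factors. *)
Lemma bounded_sums_prod {R : numDomainType} {I J : choiceType}
    (f : I -> R) (g : J -> R) :
  (forall i, 0 <= f i) -> (forall j, 0 <= g j) ->
  bounded_sums f -> bounded_sums g ->
  bounded_sums (fun p : I * J => f p.1 * g p.2).
Proof.
move=> f0 g0 [M fM] [N gN]; exists (M * N) => A.
pose A1 := [fset p.1 | p in A]%fset; pose A2 := [fset p.2 | p in A]%fset.
have : \sum_(p <- (A1 `*` A2)%fset) f p.1 * g p.2 <= M * N.
  rewrite big_imfset2 /=; last by move=> [??] [??] _ _ /= [-> ->].
  under eq_bigr do rewrite -mulr_sumr.
  rewrite -mulr_suml; apply: ler_pM => //; exact: sumr_ge0.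
apply: le_trans; apply: ler_sum_fset; first by move=> p; apply: mulr_ge0.
apply/fsubsetP => p pA; rewrite in_fsetM !in_imfset //.
Qed.

(** * Gaussian decay of the terms where rs >= 0 *)

Lemma binz2E (r : int) : 2 * binz2 r = r * (r - 1).
Proof.
rewrite /binz2 mulrC divzK //.
have [m [-> | ->]] : exists m : int, r = 2 * m \/ r = 2 * m + 1.
- by exists (r %/ 2)%Z; lia.
- by rewrite -mulrA dvdz_mulr.
- by rewrite addrK mulrCA dvdz_mulr.
Qed.

Lemma binz2D (r l : int) : binz2 (r + l) = binz2 r + binz2 l + r * l.
Proof.
by apply: (@mulfI _ 2) => //; rewrite !mulrDr !binz2E; ring.
Qed.

(** Take [m] with [Y Q^m <= 1]. For [n >= m] the term is [(Y Q^n)^n <= 1]; for [n < m] it is at most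
    [Y^n <= (1 + Y)^m]. *)
Lemma gauss_nat_bound {R : realType} (Y Q : R) :
  0 < Y -> 0 < Q -> Q < 1 ->
  exists2 C, 0 < C & forall n : nat, Y ^+ n * Q ^+ (n * n) <= C.
Proof.
move=> Y0 Q0 Q1.
have [m Ym] : exists m, Y * Q ^+ m <= 1.
  have /cvgr0Pnorm_le /(_ Y^-1) : (Q ^+ n @[n --> \oo] --> (0 : R))%classic.
    by apply: cvg_expr; rewrite ger0_norm ?ltW.
  rewrite invr_gt0 => /(_ Y0) [m _ /(_ m (leqnn m))] /=.
  rewrite (ger0_norm (exprn_ge0 _ (ltW Q0))) => h.
  by exists m; rewrite mulrC -ler_pdivlMr // mul1r.
exists ((1 + Y) ^+ m) => [|n]; first by rewrite exprn_gt0 //; lra.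
have [mn|nm] := leqP m n.
  apply: (@le_trans _ _ 1); last by rewrite exprn_ege1 //; lra.
  rewrite exprM -exprMn; apply: exprn_ile1.
    by rewrite mulr_ge0 ?exprn_ge0 ?ltW.
  apply: le_trans Ym; rewrite ler_pM2l //.
  by rewrite ler_wiXn2l ?ltW.
apply: (@le_trans _ _ (Y ^+ n)).
  by rewrite ler_piMr ?exprn_ge0 ?exprn_ile1 ?ltW.
apply: (@le_trans _ _ ((1 + Y) ^+ n)).
  by rewrite lerXn2r ?nnegrE //; lra.
by rewrite ler_weXn2l //; [lra | exact: ltnW].
Qed.

(** After division by [rho ^ |r|], this is [gauss_nat_bound] for [X / rho] when r >= 0 and for
    [1 / (X rho)] when r < 0. *)
Lemma gauss_bound {R : realType} (X Q rho : R) :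
  0 < X -> 0 < Q -> Q < 1 -> 0 < rho ->
  exists2 C, 0 < C & forall r : int, X ^ r * Q ^ (r * r) <= C * rho ^+ `|r|%N.
Proof.
move=> X0 Q0 Q1 rho0.
have [|||C C0 hC] := gauss_nat_bound (X / rho) Q => //; first exact: divr_gt0.
have [|||D D0 hD] := gauss_nat_bound (X^-1 / rho) Q => //.
  by rewrite divr_gt0 ?invr_gt0.
exists (C + D) => [|r]; first exact: addr_gt0.
rewrite -ler_pdivrMr ?exprn_gt0 //.
have -> : Q ^ (r * r) = Q ^+ (`|r| * `|r|)%N.
  by rewrite exprnP; congr (Q ^ _); lia.
rewrite mulrAC.
have [r0|r0] := leP 0 r.
  apply: le_trans (_ : C <= _); last by rewrite lerDl ltW.
  apply: le_trans (hC `|r|%N); rewrite exprMn exprVn.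
  by rewrite -[in X ^ r](gez0_abs r0) -exprnP.
apply: le_trans (_ : D <= _); last by rewrite lerDr ltW.
apply: le_trans (hD `|r|%N); rewrite exprMn !exprVn.
by rewrite -[in X ^ r](opprK r) -(ltz0_abs r0) -exprnN.
Qed.

Lemma quad_form_lb (a b c r s : int) :
  0 < a -> 0 < c -> 0 <= b \/ b * b < a * c -> 0 <= r * s ->
  r * r + s * s <= (a + c) * (a * (r * r) + 2 * (b * r * s) + c * (s * s)).
Proof.
move=> a0 c0 hb rs.
have sq (t : int) : 0 <= t * t by rewrite -expr2 sqr_ge0.
have r2 := sq r; have s2 := sq s.
case: hb => hb.
  have h : r * r + s * s <= a * (r * r) + 2 * (b * r * s) + c * (s * s) by nia.
  nia.
(* Cayley-Hamilton for the matrix M of the form: tr(M) M = M^2 + det(M) I, evaluated at v = (r, s),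
   where the M^2 part is |Mv|^2. The integer det(M) = ac - b^2 is positive, hence at least 1. *)
rewrite (_ : (a + c) * _ = (a * r + b * s) * (a * r + b * s)
  + (b * r + c * s) * (b * r + c * s) + (a * c - b * b) * (r * r + s * s));
  last by ring.
rewrite (le_trans (_ : _ <= (a * c - b * b) * (r * r + s * s))) //.
  by rewrite ler_peMl ?addr_ge0 //; lia.
by rewrite lerDr addr_ge0.
Qed.

Lemma ler_iXz2l {R : realFieldType} (Q : R) (u v : int) :
  0 < Q -> Q <= 1 -> u <= v -> Q ^ v <= Q ^ u.
Proof.
move=> Q0 Q1 uv; rewrite -(opprK u) -(opprK v) -!(exprz_inv Q).
by apply: ler_weXz2l; rewrite ?lerN2 // invf_ge1.
Qed.

Lemma quad_bound {R : realType} (a b c : int) (X Y Q : R) :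
  0 < X -> 0 < Y -> 0 < Q -> Q < 1 ->
  0 < a -> 0 < c -> 0 <= b \/ b * b < a * c ->
  exists2 K, 0 <= K & forall r s : int, 0 <= r * s ->
    X ^ r * Y ^ s * Q ^ (a * binz2 r + b * r * s + c * binz2 s)
      <= K * (2^-1 ^+ `|r|%N * 2^-1 ^+ `|s|%N).
Proof.
move=> X0 Y0 Q0 Q1 a0 c0 hb.
(* Raising to the power n = 2(a+c) clears denominators: the exponent of q times
   n is at least r^2 + s^2 - (a+c)(ar + cs), which separates r from s. *)
pose n := `|(2 * (a + c))%R|%N.
have nE : n%:Z = 2 * (a + c) by rewrite /n; lia.
have n0 : (0 < n)%N by lia.
(* The ratio is 2^-n because taking n-th roots must leave 1/2. *)
have rho0 : 0 < (2^-1 : R) ^+ n by rewrite exprn_gt0 //; lra.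
(* The extra powers of [Q] here and below absorb the linear terms -(a+c)ar and -(a+c)cs of the
   exponent. *)
have X'0 : 0 < X ^+ n * Q ^ (- ((a + c) * a)).
  by rewrite mulr_gt0 ?exprn_gt0 ?exprz_gt0.
have Y'0 : 0 < Y ^+ n * Q ^ (- ((a + c) * c)).
  by rewrite mulr_gt0 ?exprn_gt0 ?exprz_gt0.
have [C C0 hC] := gauss_bound _ _ _ X'0 Q0 Q1 rho0.
have [D D0 hD] := gauss_bound _ _ _ Y'0 Q0 Q1 rho0.
have CD : 0 < C * D by exact: mulr_gt0.
have half0 : 0 <= (2^-1 : R) by lra.
(* The constant [K] must satisfy [C * D <= K ^ n]; as [1 + C * D] is at least 1, its n-th power
   dominates it. *)
exists (1 + C * D) => [|r s rs]; first lra.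
have Qn0 : Q != 0 by rewrite gt_eqF.
rewrite -(@ler_pXn2r _ n) ?nnegrE //; last 2 first.
- by rewrite !mulr_ge0 ?exprz_ge0 // ltW.
- by rewrite !mulr_ge0 ?exprn_ge0 //; lra.
rewrite !exprMn.
apply: (@le_trans _ _ (C * (2^-1 ^+ n) ^+ `|r|%N
                      * (D * (2^-1 ^+ n) ^+ `|s|%N))); last first.
  rewrite mulrACA -!exprM ![(n * _)%N]mulnC ler_wpM2r ?mulr_ge0 ?exprn_ge0 //.
  by apply: (@le_trans _ _ (1 + C * D)); [lra | rewrite ler_eXnr //; lra].
apply: le_trans (ler_pM _ _ (hC r) (hD s)); last 2 first.
- by rewrite !mulr_ge0 ?exprz_ge0 ?mulr_ge0 ?exprn_ge0 ?exprz_ge0 // ltW.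
- by rewrite !mulr_ge0 ?exprz_ge0 ?mulr_ge0 ?exprn_ge0 ?exprz_ge0 // ltW.
rewrite !expfzMl !exprnP ![(_ ^ n) ^ _]exprzAC.
set u := a * _ + _ + _.
have -> (A B A' B' S T : R) :
    A * A' * S * (B * B' * T) = A * B * (A' * S * (B' * T)) by ring.
apply: ler_wpM2l; first by rewrite mulr_ge0 ?exprz_ge0 ?ltW.
(* Since Q < 1, the exponents compare in the opposite direction, which reduces the claim to
   [quad_form_lb]. *)
rewrite !exprz_exp -!expfzDr //; apply: (ler_iXz2l _ _ _ Q0 (ltW Q1)).
rewrite nE /u.
have := quad_form_lb a b c r s a0 c0 hb rs.
have := binz2E r; have := binz2E s; move: (binz2 r) (binz2 s) => B1 B2 h1 h2 h.
have -> : (a * B1 + b * r * s + c * B2) * (2 * (a + c)) =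
  (a + c) * (a * (2 * B1) + 2 * (b * r * s) + c * (2 * B2)) by ring.
rewrite h1 h2.
have -> : (a + c) * (a * (r * (r - 1)) + 2 * (b * r * s) + c * (s * (s - 1))) =
  (a + c) * (a * (r * r) + 2 * (b * r * s) + c * (s * s))
  - (a + c) * a * r - (a + c) * c * s by ring.
by lia.
Qed.

(** * Signed finite sums as weights on the lattice *)

(** The difference of step functions is the indicator of [A, B] when A <= B and minus that of
    [B+1, A-1] otherwise, so one expression covers both branches of [zsum]. *)
Lemma zsum_delta {K : pzRingType} (A B r : int) (f : int -> K) :
  zsum A B (fun j => if r == j then f j else 0)
  = ((A <= r)%R%:R - (B < r)%R%:R) * f r.
Proof.
(* Both branches run over a half-open interval [C, C+n): the first over [A, B+1), the second, up to
   sign, over [B+1, A). *)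
have sumE (C : int) n : \sum_(i < n) (if r == C + i%:Z then f (C + i%:Z) else 0)
    = ((C <= r)%R%:R - (C + n%:Z <= r)%R%:R) * f r.
  elim: n => [|n IH]; first by rewrite big_ord0 addr0 subrr mul0r.
  rewrite big_ord_recr /= IH.
  have [->|rn] := eqVneq r (C + n%:Z).
    have -> : (C <= C + n%:Z)%R by lia.
    have -> : (C + n%:Z <= C + n%:Z)%R by lia.
    have -> : (C + n.+1%:Z <= C + n%:Z)%R = false by lia.
    by rewrite subrr mul0r subr0 mul1r add0r.
  by rewrite addr0; congr ((_ - _%:R) * _); lia.
rewrite /zsum; case: ifP => AB; rewrite sumE.
  by congr ((_ - (_ : bool)%:R) * _); lia.
rewrite -mulNr opprB.
by congr (((_ : bool)%:R - (_ : bool)%:R) * _); lia.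
Qed.

(** A ring-valued weight turns g into a single series over pairs and the comparison of weights into
    a polynomial identity. *)
Definition quadrants {K : pzRingType} (r s : int) : K :=
  (0 <= r)%R%:R * (0 <= s)%R%:R + (r < 0)%R%:R * (s < 0)%R%:R.

Lemma quadrants_shift {K : comPzRingType} (l k r s : int) :
  quadrants r s = quadrants (r - l) (s - k)
    + ((0 <= r)%R%:R - (l - 1 < r)%R%:R) * (sg s)%:~R
    + ((0 <= s)%R%:R - (k - 1 < s)%R%:R) * (sg r)%:~R
    - 2 * (((0 <= r)%R%:R - (l - 1 < r)%R%:R)
           * ((0 <= s)%R%:R - (k - 1 < s)%R%:R)) :> K.
Proof.
have sgE (t : int) : (sg t)%:~R = 2 * (0 <= t)%R%:R - 1 :> K.
  by rewrite /sg; case: ifP => _ /=; ring.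
have ltE (t : int) : (t < 0)%R%:R = 1 - (0 <= t)%R%:R :> K.
  by rewrite ltNge; case: (0 <= t) => /=; ring.
rewrite /quadrants !sgE !ltE.
(* The upper limit l - 1 of the finite sum matches the boundary r >= l of the shifted quadrant. *)
have -> : (l - 1 < r) = (0 <= r - l) by lia.
have -> : (k - 1 < s) = (0 <= s - k) by lia.
ring.
Qed.

(** Extension by zero puts a one-variable series on the index set of the double series, so that they
    can be added termwise. *)
Lemma has_sum_row {K : numFieldType} {I J : choiceType} (i0 : I)
    (f : I -> J -> K) (s : K) :
  has_sum (f i0) s -> has_sum (fun p => if p.1 == i0 then f i0 p.2 else 0) s.
Proof.
move=> h; apply: (@has_sum_inj _ _ _ (pair i0) snd) => //.
- by move=> [i j] /=; rewrite xpair_eqE eqxx andbT eq_sym => /negPf ->.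
- by rewrite /comp /= eqxx.
Qed.

Lemma has_sum_col {K : numFieldType} {I J : choiceType} (j0 : J)
    (f : I -> J -> K) (s : K) :
  has_sum (f^~ j0) s -> has_sum (fun p => if p.2 == j0 then f p.1 j0 else 0) s.
Proof.
move=> h; apply: (@has_sum_inj _ _ _ (pair^~ j0) fst) => //.
- by move=> [i j] /=; rewrite xpair_eqE eqxx /= eq_sym => /negPf ->.
- by rewrite /comp /= eqxx.
Qed.

Lemma has_sum_unique {R : realType} {I : choiceType} (f : I -> R[i])
    (s t : R[i]) :
  has_sum f s -> has_sum f t -> s = t.
Proof. by move=> /has_sum_csum <- /has_sum_csum. Qed.

(** Every term on the right becomes a family on pairs. Their combination agrees pointwise with the
    family on the left by [quadrants_shift], and sums are unique. *)
Lemma quadrant_sum_shift {R : realType} (T : int -> int -> R[i]) (l k : int)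
    (G G' : R[i]) (rows cols : int -> R[i]) :
  has_sum (fun p => quadrants p.1 p.2 * T p.1 p.2) G ->
  has_sum (fun p => quadrants p.1 p.2 * T (p.1 + l) (p.2 + k)) G' ->
  (forall r, has_sum (fun s => (sg s)%:~R * T r s) (rows r)) ->
  (forall s, has_sum (fun r => (sg r)%:~R * T r s) (cols s)) ->
  G = G' + zsum 0 (l - 1) rows + zsum 0 (k - 1) cols
      - 2 * zsum 0 (l - 1) (fun r => zsum 0 (k - 1) (T r)).
Proof.
move=> hG hG' hr hc.
have {}hG' : has_sum (fun p => quadrants (p.1 - l) (p.2 - k) * T p.1 p.2) G'.
  apply: (@has_sum_inj _ _ _ (fun p => (p.1 + l, p.2 + k))
                             (fun p => (p.1 - l, p.2 - k))).
  - by move=> [r s] /=; rewrite !addrK.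
  - by move=> [r s] /=; rewrite !subrK eqxx.
  - by rewrite /comp /=; under eq_fun do rewrite !addrK.
have hrows := has_sum_zsum 0 (l - 1) _ _
  (fun r => has_sum_row r (fun r s => (sg s)%:~R * T r s) _ (hr r)).
have hcols := has_sum_zsum 0 (k - 1) _ _
  (fun s => has_sum_col s (fun r s => (sg r)%:~R * T r s) _ (hc s)).
(* The finite double sum is assembled from families supported at a single point. *)
have hrect := has_sum_zsum 0 (l - 1) _ _ (fun r => has_sum_zsum 0 (k - 1) _ _
  (fun s => @has_sum_single R[i] _ (r, s) (T r s))).
apply: has_sum_unique hG _.
have := has_sumD _ _ _ _ (has_sumD _ _ _ _ (has_sumD _ _ _ _ hG' hrows) hcols)
  (has_sumN _ _ (has_sumZ 2 _ _ hrect)).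
congr has_sum; apply/funext => -[r s] /=.
rewrite !zsum_delta.
have -> : zsum 0 (l - 1) (fun r' => zsum 0 (k - 1)
      (fun s' => if (r, s) == (r', s') then T r' s' else 0)) =
    zsum 0 (l - 1) (fun r' => if r == r' then
      ((0 <= s)%R%:R - (k - 1 < s)%R%:R) * T r' s else 0).
  congr zsum; apply/funext => r'; rewrite -zsum_delta.
  case: eqVneq => [->|rr'].
    by congr zsum; apply/funext => s'; rewrite xpair_eqE eqxx.
  under eq_fun do rewrite xpair_eqE (negPf rr').
  by rewrite /zsum; case: ifP => _; rewrite big1 ?oppr0.
by rewrite zsum_delta (quadrants_shift l k r s); ring.
Qed.

(** * The terms of g: translation and summability *)

(** The sign (-1)^(r+s) is absorbed into -x and -y, the form that the finite sums of the theorem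
    have. *)
Definition gterm {R : realType} (a b c : int) (x y q : R[i]) (r s : int) : R[i] :=
  (- x) ^ r * (- y) ^ s * q ^ (a * binz2 r + b * r * s + c * binz2 s).

(** Expanding the quadratic exponent leaves the cross terms (al+bk)r and (bl+ck)s, which rescale x
    and y. *)
Lemma gterm_shift {R : realType} (a b c : int) (x y q : R[i]) (r s l k : int) :
  q != 0 -> x != 0 -> y != 0 ->
  gterm a b c x y q (r + l) (s + k) = gterm a b c x y q l k *
    gterm a b c (q ^ (a * l + b * k) * x) (q ^ (b * l + c * k) * y) q r s.
Proof.
move=> q0 x0 y0; rewrite /gterm !binz2D -!mulrN.
rewrite ![(_ * - _) ^ _]expfzMl !exprz_exp.
rewrite !(@expfzDr _ (- _)) ?oppr_eq0 //.
rewrite (_ : a * (binz2 r + binz2 l + r * l) + b * (r + l) * (s + k)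
    + c * (binz2 s + binz2 k + s * k) =
  (a * binz2 l + b * l * k + c * binz2 k) + (a * l + b * k) * r
  + (b * l + c * k) * s + (a * binz2 r + b * r * s + c * binz2 s)); last by ring.
by rewrite !(expfzDr _ _ q0); ring.
Qed.

Lemma normcXz {R : rcfType} (z : R[i]) (n : int) : normc (z ^ n) = normc z ^ n.
Proof.
have nat (u : R[i]) (m : nat) : normc (u ^+ m) = normc u ^+ m.
  by elim: m => [|m IH]; rewrite ?normc1 // !exprS normcM IH.
by case: (intP n) => [|m|m]; rewrite ?normc1 // -?exprz_inv -?exprnP nat ?normcV.
Qed.

Lemma normc_gt0 {R : rcfType} (z : R[i]) : z != 0 -> 0 < normc z.
Proof.
move=> z0; rewrite lt_def normc_ge0 andbT.
by apply: contra z0 => /eqP/eq0_normc ->.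
Qed.

Lemma gterm_bound {R : realType} (a b c : int) (x y q : R[i]) :
  0 < `|q| -> `|q| < 1 -> 0 < a -> 0 < c -> 0 <= b \/ b * b < a * c ->
  x != 0 -> y != 0 ->
  exists2 K, 0 <= K & forall r s : int, 0 <= r * s ->
    normc (gterm a b c x y q r s) <= K * (2^-1 ^+ `|r|%N * 2^-1 ^+ `|s|%N).
Proof.
rewrite normr_gt0 => /normc_gt0 q0; rewrite normCE -[1]/(1%:C) ltcR => q1.
move=> a0 c0 hb /normc_gt0 x0 /normc_gt0 y0.
have [K K0 hK] := quad_bound a b c _ _ _ x0 y0 q0 q1 a0 c0 hb.
by exists K => // r s /hK; rewrite /gterm !normcM !normcXz !normcN.
Qed.

(** A general region [D] inside rs >= 0 lets one statement serve both quadrants; the majorant is a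
    product of two geometric series. *)
Lemma gterm_quadrant_summable {R : realType} (a b c : int) (x y q : R[i])
    (D : pred (int * int)) :
  0 < `|q| -> `|q| < 1 -> 0 < a -> 0 < c -> 0 <= b \/ b * b < a * c ->
  x != 0 -> y != 0 -> (forall p, D p -> 0 <= p.1 * p.2) ->
  let f p := if D p then gterm a b c x y q p.1 p.2 else 0 in
  has_sum f (csum f).
Proof.
move=> q0 q1 a0 c0 hb x0 y0 D0 f; apply: abs_summable.
have [K K0 hK] := gterm_bound a b c x y q q0 q1 a0 c0 hb x0 y0.
have half0 : 0 <= (2^-1 : R) by lra.
apply: le_bounded_sums; last first.
  apply: (bounded_sumsM _ _ K0).
  apply: bounded_sums_prod (@bounded_sums_geom R) (@bounded_sums_geom R);
    by move=> i; exact: exprn_ge0.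
move=> p /=; rewrite /f; case: ifP => [/D0 /hK //|_].
by rewrite normc0 !mulr_ge0 ?exprn_ge0.
Qed.

Lemma g_has_sum {R : realType} (a b c : int) (x y q : R[i]) :
  0 < `|q| -> `|q| < 1 -> 0 < a -> 0 < c -> 0 <= b \/ b * b < a * c ->
  x != 0 -> y != 0 ->
  has_sum (fun p => quadrants p.1 p.2 * gterm a b c x y q p.1 p.2) (g a b c x y q).
Proof.
move=> q0 q1 a0 c0 hb x0 y0; rewrite /g /csum_on.
have termE (p : int * int) : (-1) ^ (p.1 + p.2) * x ^ p.1 * y ^ p.2
      * q ^ (a * binz2 p.1 + b * p.1 * p.2 + c * binz2 p.2) =
    gterm a b c x y q p.1 p.2.
  rewrite /gterm -(mulN1r x) -(mulN1r y) !expfzMl expfzDr ?oppr_eq0 ?oner_eq0 //.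
  by ring.
under [X in csum X + _]eq_fun do rewrite termE.
under [X in _ + csum X]eq_fun do rewrite termE.
have summ D := gterm_quadrant_summable a b c x y q D q0 q1 a0 c0 hb x0 y0.
have h1 := summ (fun p => (0 <= p.1) && (0 <= p.2)).
have h2 := summ (fun p => (p.1 < 0) && (p.2 < 0)).
have := has_sumD _ _ _ _ (h1 _) (h2 _).
have -> : (fun p : int * int => quadrants p.1 p.2 * gterm a b c x y q p.1 p.2) =
  (fun p => (if (0 <= p.1) && (0 <= p.2) then gterm a b c x y q p.1 p.2 else 0)
    + (if (p.1 < 0) && (p.2 < 0) then gterm a b c x y q p.1 p.2 else 0)).
  apply/funext => p; rewrite /quadrants -!natrM !mulnb mulrDl.
  by congr (_ + _); case: ifP; rewrite (mul1r, mul0r).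
by apply; move=> p /andP[]; nia.
Qed.

(** Up to sign, [f s] is the r = 0 term of [gterm] with a = 1, b = 0, x = -1 and y = -(q^d z), so
    its bound is geometric in s alone. *)
Lemma theta_summable {R : realType} (c d : int) (z q : R[i]) :
  0 < `|q| -> `|q| < 1 -> 0 < c -> z != 0 ->
  let f s := (sg s)%:~R * z ^ s * q ^ (d * s) * q ^ (c * binz2 s) in
  has_sum f (csum f).
Proof.
move=> q0 q1 c0 z0 f; apply: abs_summable.
have N1 : (-1 : R[i]) != 0 by rewrite oppr_eq0 oner_eq0.
have w0 : - (q ^ d * z) != 0.
  by rewrite oppr_eq0 mulf_neq0 ?expfz_neq0 // -normr_gt0.
have [K K0 hK] := gterm_bound 1 0 c (-1) _ q q0 q1 ltr01 c0
  (or_introl (lexx _)) N1 w0.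
apply: le_bounded_sums; last exact: (bounded_sumsM _ _ K0 bounded_sums_geom).
move=> s; have := hK 0 s; rewrite mul0r => /(_ (lexx _)).
rewrite (_ : gterm _ _ _ _ _ _ _ _ = z ^ s * q ^ (d * s) * q ^ (c * binz2 s)).
  rewrite absz0 expr0 mul1r.
  have -> // : normc (f s) = normc (z ^ s * q ^ (d * s) * q ^ (c * binz2 s)).
  rewrite /f -!(mulrA (sg s)%:~R) normcM -[RHS]mul1r; congr (_ * _).
  by rewrite /sg; case: ifP; rewrite ?normcN normc1.
rewrite /gterm !opprK exp1rz /binz2 !mul0r div0z mulr0 !add0r mul1r.
by rewrite expfzMl exprz_exp [z ^ s * _]mulrC.
Qed.

Theorem proposition2p5 (R : realType) (q : R[i]) (a b c : int) (x y : R[i])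
    (l k : int) (hq0 : 0 < `|q|) (hq1 : `|q| < 1) (ha : 0 < a) (hc : 0 < c)
    (hb : - Num.sqrt ((a * c)%:~R : R) < b%:~R) (hx : x != 0) (hy : y != 0) :
  g a b c x y q =
    (- x) ^ l * (- y) ^ k * q ^ (a * binz2 l + b * l * k + c * binz2 k)
      * g a b c (q ^ (a * l + b * k) * x) (q ^ (b * l + c * k) * y) q
    + zsum 0 (l - 1) (fun r => (- x) ^ r * q ^ (a * binz2 r)
        * csum (fun s : int => (sg s)%:~R * (- y) ^ s * q ^ (b * r * s)
                               * q ^ (c * binz2 s)))
    + zsum 0 (k - 1) (fun s => (- y) ^ s * q ^ (c * binz2 s)
        * csum (fun r : int => (sg r)%:~R * (- x) ^ r * q ^ (b * r * s)
                               * q ^ (a * binz2 r)))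
    - 2 * zsum 0 (l - 1) (fun r => zsum 0 (k - 1) (fun s =>
        (- x) ^ r * (- y) ^ s
          * q ^ (a * binz2 r + b * r * s + c * binz2 s))).
Proof.
have q0 : q != 0 by rewrite -normr_gt0.
(* For b < 0 the hypothesis reads 0 < -b < sqrt(ac); squaring gives a condition on integers. *)
have {}hb : 0 <= b \/ b * b < a * c.
  have [b0|b0] := leP 0 b; [by left | right].
  have ac0 : 0 <= (a * c)%:~R :> R by rewrite ler0z mulr_ge0 ?ltW.
  have bb : - b%:~R < Num.sqrt ((a * c)%:~R : R) by rewrite ltrNl.
  rewrite -(ltr_int R) -(sqr_sqrtr ac0) intrM -mulrNN -expr2.
  by rewrite ltr_pXn2r ?nnegrE ?sqrtr_ge0 // oppr_ge0 lerz0 ltW.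
have rowE r : (fun s => (sg s)%:~R * gterm a b c x y q r s) =
    (fun s => (- x) ^ r * q ^ (a * binz2 r)
      * ((sg s)%:~R * (- y) ^ s * q ^ (b * r * s) * q ^ (c * binz2 s))).
  by apply/funext => s; rewrite /gterm !(expfzDr _ _ q0); ring.
have colE s : (fun r => (sg r)%:~R * gterm a b c x y q r s) =
    (fun r => (- y) ^ s * q ^ (c * binz2 s)
      * ((sg r)%:~R * (- x) ^ r * q ^ (b * s * r) * q ^ (a * binz2 r))).
  by apply/funext => r; rewrite /gterm (mulrAC b s) !(expfzDr _ _ q0); ring.
apply: (@quadrant_sum_shift _ (gterm a b c x y q)).
- exact: g_has_sum.
(* The constant pulled out, [gterm a b c x y q l k], is the prefactor of the shifted g. *)
- under eq_fun do rewrite gterm_shift // mulrCA.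
  by apply/has_sumZ/g_has_sum => //; rewrite mulf_neq0 ?expfz_neq0.
- by move=> r; rewrite rowE; apply/has_sumZ/theta_summable => //; rewrite oppr_eq0.
- move=> s; rewrite colE; under [X in csum X]eq_fun do rewrite (mulrAC b _ s).
  by apply/has_sumZ/theta_summable => //; rewrite oppr_eq0.
Qed.
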